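(* Let $(X,d)$ and $(Y,\rho)$ be compact metric spaces, and let $\boldsymbol f=\{f_i\}_{i=1}^\infty$ and $\boldsymbol g=\{g_i\}_{i=1}^\infty$ be sequences of continuous self-maps of $X$ and $Y$, respectively. Suppose $\pi$ is a factor map from $(X,\boldsymbol f)$ to $(Y,\boldsymbol g)$, i.e. $\pi:X\to Y$ is a continuous surjection with $\pi\circ f_i=g_i\circ\pi$ for all $i\ge1$. Then for every subset $Z\subseteq X$, every $\theta\in[0,1]$ and every $\varphi\in C(Y,\mathbb R)$, $$\underline P(\boldsymbol f,Z,\varphi\circ\pi,\theta)\ge\underline P(\boldsymbol g,\pi(Z),\varphi,\theta),\qquad \overline P(\boldsymbol f,Z,\varphi\circ\pi,\theta)\ge\overline P(\boldsymbol g,\pi(Z),\varphi,\theta).$$ If $\pi$ is a conjugacy (i.e. in addition $\pi$ is a homeomorphism), then equality holds: $$\underline P(\boldsymbol f,Z,\varphi\circ\pi,\theta)=\underline P(\boldsymbol g,\pi(Z),\varphi,\theta),\qquad \overline P(\boldsymbol f,Z,\varphi\circ\pi,\theta)=\overline P(\boldsymbol g,\pi(Z),\varphi,\theta).$$ Here $\underline P,\overline P$ denote the lower and upper $\theta$-intermediate topological pressures.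
   Context: Pressures take values in $[-\infty,+\infty]$. $C(Y,\mathbb R)$ is the space of continuous real functions on $Y$. The pressures are defined as follows for any sequence $\boldsymbol f=\{f_i\}_{i\ge1}$ of continuous self-maps of a compact metric space $X$ and continuous $\varphi:X\to\mathbb R$ (and likewise for $(Y,\boldsymbol g)$). Put $f_1^0=\mathrm{id}_X$, $f_1^n=f_n\circ\cdots\circ f_1$, and $S_n\varphi(x)=\sum_{j=0}^{n-1}\varphi(f_1^j x)$. For a finite open cover $\mathcal U$ of $X$, $\mathcal S_m(\mathcal U)$ is the set of strings $\mathbf U=(U_0,\dots,U_{m-1})$ with all $U_j\in\mathcal U$; $m(\mathbf U)=m$ is the length of $\mathbf U$; and $X(\mathbf U)=\{x\in X: f_1^j(x)\in U_j,\ 0\le j\le m-1\}$. For $Z\subseteq X$, $\alpha\in\mathbb R$, $N\in\mathbb N$, $\theta\in[0,1]$ let $$M(Z,\alpha,\varphi,\mathcal U,N,\theta)=\inf_{\mathcal G}\sum_{\mathbf U\in\mathcal G}\exp\Bigl(-\alpha m(\mathbf U)+\sup_{x\in X(\mathbf U)}S_{m(\mathbf U)}\varphi(x)\Bigr),$$ the infimum over all finite or countable collections $\mathcal G$ of strings of lengths $m$ with $N\le m<N/\theta+1$ (for $\theta=0$: $m\ge N$) such that $Z\subseteq\bigcup_{\mathbf U\in\mathcal G}X(\mathbf U)$; the supremum over an empty $X(\mathbf U)$ is $-\infty$ (so the term is $0$). Let $\underline m$ and $\overline m$ be the $\liminf$ and $\limsup$ of $M(Z,\alpha,\varphi,\mathcal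 U,N,\theta)$ as $N\to\infty$, and $$\underline P(\boldsymbol f,Z,\varphi,\mathcal U,\theta)=\inf\{\alpha:\underline m=0\}=\sup\{\alpha:\underline m=\infty\},\quad \overline P(\boldsymbol f,Z,\varphi,\mathcal U,\theta)=\inf\{\alpha:\overline m=0\}=\sup\{\alpha:\overline m=\infty\}.$$ With $|\mathcal U|=\max_{U\in\mathcal U}\operatorname{diam}U$, the lower and upper $\theta$-intermediate topological pressures are $\underline P(\boldsymbol f,Z,\varphi,\theta)=\lim_{|\mathcal U|\to0}\underline P(\boldsymbol f,Z,\varphi,\mathcal U,\theta)$ and $\overline P(\boldsymbol f,Z,\varphi,\theta)=\lim_{|\mathcal U|\to0}\overline P(\boldsymbol f,Z,\varphi,\mathcal U,\theta)$ (these limits exist). *)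

(* Defs.v *)
From HB Require Import structures.
From mathcomp Require Import all_boot all_order all_algebra.
From mathcomp Require Import all_classical all_reals all_analysis.

Set Implicit Arguments.
Unset Strict Implicit.
Unset Printing Implicit Defensive.

Import Order.TTheory GRing.Theory Num.Theory.
Import numFieldNormedType.Exports.

Local Open Scope classical_set_scope.
Local Open Scope ring_scope.

Section Pressure.
Context {R : realType} {X : metricType R}.

(* Sequences of maps are indexed from 1: the value [f 0] is never used. *)
Implicit Types (f : nat -> X -> X) (phi : X -> R) (Z A : set X).
Implicit Types (U : set (set X)) (s : seq (set X)) (G : set (seq (set X))).
Implicit Types (a theta : R) (N : nat).

(* [time_iter f n] is f_1^n = f_n \o ... \o f_1. *)
Fixpoint time_iter f n : X -> X :=
  if n is m.+1 then f m.+1 \o time_iter f m else id.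

Definition birkhoff_sum f phi n (x : X) : R :=
  \sum_(0 <= j < n) phi (time_iter f j x).

Definition finite_open_cover U : Prop :=
  [/\ finite_set U, (forall A, U A -> open A) & \bigcup_(A in U) A = setT].

(* In the next two definitions the supremum of an empty family is -oo rather
   than 0; this does not affect comparisons with a positive real number. *)
Definition diam A : \bar R :=
  ereal_sup [set (mdist p.1 p.2)%:E | p in A `*` A].

Definition mesh U : \bar R := ereal_sup [set diam A | A in U].

(* The filter "|U| -> 0" on finite open covers. *)
Definition mesh_to0 : set_system (set (set X)) :=
  filter_from [set e : R | 0 < e]
    (fun e => [set U | finite_open_cover U /\ (mesh U < e%:E)%E]).

(* A string is a sequence of sets; its length is its [size]. *)
Definition string_over U s : Prop :=
  forall j, (j < size s)%N -> U (nth set0 s j).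

Definition string_set f s : set X :=
  [set x | forall j, (j < size s)%N -> nth set0 s j (time_iter f j x)].

(* N <= m < N / theta + 1, where N / 0 is read as +oo. *)
Definition admissible_length N theta (m : nat) : Prop :=
  (N <= m)%N /\ (theta != 0 -> m%:R < N%:R / theta + 1).

Definition admissible_family f Z U N theta G : Prop :=
  [/\ countable G,
      (forall s, G s -> string_over U s /\ admissible_length N theta (size s))
    & Z `<=` \bigcup_(s in G) string_set f s].

(* [expeR -oo = 0], so a string with empty [string_set] contributes 0. *)
Definition string_weight f a phi s : \bar R :=
  expeR (- (a * (size s)%:R)%:E +
    ereal_sup [set (birkhoff_sum f phi (size s) x)%:E | x in string_set f s])%E.

Definition pressure_sum f Z a phi U N theta : \bar R :=
  ereal_inf [set (\esum_(s in G) string_weight f a phi s)%E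
            | G in admissible_family f Z U N theta].

Definition lower_cover_pressure f Z phi U theta : \bar R :=
  ereal_inf [set a%:E | a in
    [set a | limn_einf (fun N => pressure_sum f Z a phi U N theta) = 0%E]].

Definition upper_cover_pressure f Z phi U theta : \bar R :=
  ereal_inf [set a%:E | a in
    [set a | limn_esup (fun N => pressure_sum f Z a phi U N theta) = 0%E]].

Definition lower_pressure f Z phi theta : \bar R :=
  lim ((fun U => lower_cover_pressure f Z phi U theta) @ mesh_to0).

Definition upper_pressure f Z phi theta : \bar R :=
  lim ((fun U => upper_cover_pressure f Z phi U theta) @ mesh_to0).

End Pressure.

Section FactorMap.
Context {R : realType} {X Y : metricType R}.

Definition factor_map (f : nat -> X -> X) (g : nat -> Y -> Y) (pi : X -> Y)
    : Prop :=
  [/\ continuous pi, range pi = setT &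
      forall i, (1 <= i)%N -> pi \o f i = g i \o pi].

Definition homeomorphism (pi : X -> Y) : Prop :=
  continuous pi /\
  exists h : Y -> X, [/\ continuous h, cancel pi h & cancel h pi].

Definition conjugacy (f : nat -> X -> X) (g : nat -> Y -> Y) (pi : X -> Y)
    : Prop :=
  factor_map f g pi /\ homeomorphism pi.

End FactorMap.

(* Main.v *)
(* Let [V] be a finite open cover of [Y] on whose members [phi] oscillates by
   at most [c], and let every nonempty member of a cover [U] of [X] be mapped
   by [pi] into a member of [V].  Replacing each entry of a [U]-string by such
   a member of [V] turns a cover of [Z] into a cover of [pi @` Z] by strings of
   the same lengths [m], whose weights are larger by a factor of at most
   [exp (c * m)]; replacing [alpha] by [alpha + c] compensates for it.  Hence
   P(g, pi Z, phi, V) <= P(f, Z, phi \o pi, U) + c.  By uniform continuity,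
   [c] tends to 0 with the mesh of [V], and by the Lebesgue number lemma, for
   fixed [V], every [U] of small mesh qualifies.  For [pi = id] this is a
   Cauchy-type condition, so the limits defining the pressures exist; letting
   the meshes of [U], then [V], tend to 0 gives the inequality for a factor
   map, and equality for a conjugacy by applying it to [pi] and its inverse. *)
Require Import Defs.
From mathcomp Require Import all_boot all_order all_algebra.
From mathcomp Require Import all_classical all_reals all_analysis.
From mathcomp Require Import ring lra.
Import Order.TTheory GRing.Theory Num.Theory.
Import numFieldNormedType.Exports.
Local Open Scope classical_set_scope.
Local Open Scope ring_scope.

(** * Limits and sums in the extended reals *)

Lemma cvg_ereal_of_bounds (R : realType) (T : Type) (F : set_system T)
    {FF : Filter F} (p : T -> \bar R) (l : \bar R) :
  (forall a : R, (a%:E < l)%E -> \forall t \near F, (a%:E < p t)%E) ->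
  (forall b : R, (l < b%:E)%E -> \forall t \near F, (p t < b%:E)%E) ->
  p t @[t --> F] --> l.
Proof.
case: l => [r| |] lo hi P /=.
- move=> rP; have /nbhs_ballP[e /= e0 reP] : nbhs r (fun s => P s%:E) := rP.
  apply: filterS2 (lo (r - e) _) (hi (r + e) _);
    rewrite ?lte_fin ?ltrBlDr ?ltrDl// => t /=.
  case: (p t) => // s; rewrite !lte_fin => h1 h2; apply: reP.
  by rewrite -ball_normE /= distrC ltr_distl h1.
- move=> [M [_ MP]]; apply: filterS (lo M _) => [t|]; last exact: ltry.
  exact: MP.
- move=> [M [_ MP]]; apply: filterS (hi M _) => [t|]; last exact: ltNyr.
  exact: MP.
Qed.

(** The limit is the limit superior [l]. Above any real [a' < l] there is a value [p v] that, by the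
    one-sided hypothesis, eventually bounds [p] from below up to a small error, so the limit
    inferior is no smaller. *)
Lemma cvg_ereal_almost_le (R : realType) (T : Type) (F : set_system T)
    {FF : ProperFilter F} (p : T -> \bar R) :
  (forall e : R, 0 < e ->
     \forall v \near F, \forall u \near F, (p v <= p u + e%:E)%E) ->
  exists l : \bar R, p t @[t --> F] --> l.
Proof.
move=> pF; pose l := ereal_inf [set ereal_sup (p @` V) | V in F].
exists l; apply: cvg_ereal_of_bounds => [a al|b].
- have [a' aa' a'l] : exists2 a' : R, a < a' & (a'%:E < l)%E.
    move: al; case: l => [r| |//].
    + by rewrite lte_fin => /midf_lt[ar rr]; exists ((a + r) / 2).
    + by move=> _; exists (a + 1); rewrite ?ltrDl ?ltry.
  have [v [a'v vu]] : exists v, (a'%:E < p v)%E /\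
      \forall u \near F, (p v <= p u + (a' - a)%:E)%E.
    have e0 : 0 < a' - a by rewrite subr_gt0.
    (* Otherwise [p <= a'] on the set of all [v] with this eventual bound, a member of [F], which
       forces [l <= a']. *)
    apply: contrapT => nv.
    suff : (l <= a'%:E)%E by rewrite leNgt a'l.
    apply: ge_ereal_inf.
    exists (ereal_sup [set p v | v in
      [set v | \forall u \near F, (p v <= p u + (a' - a)%:E)%E]]).
      by eexists => //; exact: pF.
    apply: ge_ereal_sup => _ [v /= vu <-]; rewrite leNgt; apply/negP => a'v.
    by apply: nv; exists v.
  apply: filterS vu => u h; have := lt_le_trans a'v h.
  case: (p u) => [s|_|] //; last exact: ltry.
  by rewrite -EFinD !lte_fin; lra.
- move=> /ereal_inf_ltP[_ [V FV <-] supV]; apply: filterS FV => u Vu.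
  by apply: le_lt_trans supV; apply: ereal_sup_ubound; exists u.
Qed.

(** For fixed [v] the bound passes to the limit along [G], giving [p v <= m + e]; only then does [v]
    vary along [F]. *)
Lemma lim_ereal_almost_le (R : realType) (S T : Type)
    (F : set_system S) (G : set_system T)
    {FF : ProperFilter F} {GF : ProperFilter G}
    (p : S -> \bar R) (q : T -> \bar R) (l m : \bar R) :
  p t @[t --> F] --> l -> q t @[t --> G] --> m ->
  (forall e : R, 0 < e ->
     \forall v \near F, \forall u \near G, (p v <= q u + e%:E)%E) ->
  (l <= m)%E.
Proof.
move=> pl qm pq; apply/lee_addgt0Pr => e e0.
have qme : (q t + e%:E)%E @[t --> G] --> (m + e%:E)%E.
  by apply: cvgeD => //; [rewrite fin_num_adde_defl|exact: cvg_cst].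
apply: cvge_le pl; apply: filterS (pq _ e0) => v vu.
exact: cvge_ge vu qme.
Qed.

(** As [e] may identify indices, one preimage [r j] is chosen for each [j]. These preimages form a
    subset of [P], and a supremum of finite sums is monotone in the index set. *)
Lemma esum_image_le (R : realType) (T T' : choiceType) (P : set T)
    (e : T -> T') (a : T -> \bar R) (b : T' -> \bar R) :
  (forall i, P i -> (b (e i) <= a i)%E) ->
  (\esum_(j in e @` P) b j <= \esum_(i in P) a i)%E.
Proof.
move=> ba; have [->|/set0P[i0 Pi0]] := eqVneq P set0.
  by rewrite image_set0 !esum_set0.
have /choice[r rP] : forall j, exists i, (e @` P) j -> P i /\ e i = j.
  move=> j; have [[i Pi <-]|nj] := pselect ((e @` P) j); first by exists i.
  by exists i0.
apply: (@le_trans _ _ (\esum_(j in e @` P) a (r j))%E).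
  by apply: le_esum => j /rP[Pr ej]; rewrite -[in b _]ej ba.
rewrite -(esum_image _ r a) => [|i j]; last first.
  by rewrite !inE => /rP[_ {2}<-] /rP[_ {2}<-] ->.
apply: ereal_sup_le => _ [X [finX XrP] <-]; exists X => //; split=> // i.
by move=> /XrP[j /rP[Pr _] <-].
Qed.

Lemma limn_esup_le (R : realType) (u v : nat -> \bar R) :
  (forall n, (u n <= v n)%E) -> (limn_esup u <= limn_esup v)%E.
Proof.
move=> uv; apply: le_ereal_inf_tmp => _ [V FV <-]; apply: ge_ereal_inf.
exists (ereal_sup (u @` V)); first by exists V.
apply: ge_ereal_sup => _ [n Vn <-]; apply: le_ereal_sup_tmp.
by exists (v n) => //; exists n.
Qed.

Lemma limn_einf_le (R : realType) (u v : nat -> \bar R) :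
  (forall n, (u n <= v n)%E) -> (limn_einf u <= limn_einf v)%E.
Proof. by move=> uv; rewrite leeN2; apply: limn_esup_le => n; rewrite leeN2. Qed.

(** * Lifting strings and their weights along a semiconjugacy *)

Section Semiconjugacy.
Context {R : realType} {X Y : metricType R}.
Context (f : nat -> X -> X) (g : nat -> Y -> Y) (pi : X -> Y).
Hypothesis semiconj : forall i, (1 <= i)%N -> pi \o f i = g i \o pi.
Context (phi : Y -> R) (U : set (set X)) (V : set (set Y)) (c : R).
Hypothesis refine_UV : forall A, U A -> A !=set0 ->
  exists2 B, V B & pi @` A `<=` B.
Hypothesis osc_V : forall B, V B ->
  forall y y', B y -> B y' -> phi y <= phi y' + c.

Lemma time_iter_semiconj n x : pi (time_iter f n x) = time_iter g n (pi x).
Proof.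
elim: n => //= n IHn; rewrite -IHn.
exact: (congr1 (fun h => h (time_iter f n x)) (semiconj n.+1 isT)).
Qed.

(* Empty members of [U] need not be contained in a member of [V], but they
   only occur in strings with an empty string set. *)
Lemma string_lift s : string_over U s -> string_set f s !=set0 ->
  exists t, [/\ size t = size s, string_over V t &
    pi @` string_set f s `<=` string_set g t].
Proof.
move=> Us [x sx].
have /choice[b bP] : forall A, exists B, U A -> A !=set0 ->
    V B /\ pi @` A `<=` B.
  move=> A; have [[UA A0]|nA] := pselect (U A /\ A !=set0).
    by have [B VB AB] := refine_UV A UA A0; exists B.
  by exists set0 => UA A0; case: nA.
have bs j : (j < size s)%N ->
    V (b (nth set0 s j)) /\ pi @` nth set0 s j `<=` b (nth set0 s j).
  by move=> js; apply: bP; [exact: Us|exists (time_iter f j x); exact: sx].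
exists (map b s); rewrite /string_over /string_set /= size_map; split=> //.
  by move=> j js; rewrite (nth_map set0)//; have [] := bs j js.
move=> _ [z /= sz <-] j js; rewrite (nth_map set0)// -time_iter_semiconj.
by have [_] := bs j js; apply; exists (time_iter f j z) => //; exact: sz.
Qed.

(** At each time the orbits of [y] and [pi x] lie in the same member of [V], so the Birkhoff sum at
    [y] exceeds the one at [x] by at most [c * m]. A single [x] serves for all [y]. *)
Lemma string_weight_lift a s t : size t = size s -> string_over V t ->
  string_set f s !=set0 -> pi @` string_set f s `<=` string_set g t ->
  (string_weight g (a + c) phi t <= string_weight f a (phi \o pi) s)%E.
Proof.
move=> ts Vt [x sx] st; rewrite /string_weight ts lee_expeR.
set m := (size s)%:R.
have -> : (- (a * m)%:E = - ((a + c) * m)%:E + (c * m)%:E)%E.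
  by rewrite -!EFinN -EFinD; congr EFin; ring.
rewrite -addeA; apply: leeD => //; apply: ge_ereal_sup => _ [y ty <-].
apply: (@le_trans _ _ ((c * m)%:E + (birkhoff_sum f (phi \o pi) (size s) x)%:E)%E).
  have -> : c * m = \sum_(0 <= k < size s) c.
    by rewrite sumr_const_nat subn0 mulr_natr.
  rewrite -EFinD lee_fin addrC -big_split; apply: ler_sum_nat => k /andP[_ ks] /=.
  rewrite time_iter_semiconj; apply: (osc_V (nth set0 t k)).
  - by apply: Vt; rewrite ts.
  - by apply: ty; rewrite ts.
  - rewrite -time_iter_semiconj; have := st (pi x) _ k.
    by rewrite ts time_iter_semiconj; apply; [exists x|].
by apply: leeD => //; apply: ereal_sup_ubound; exists x.
Qed.

Lemma pressure_sum_lift Z a N theta :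
  (pressure_sum g (pi @` Z) (a + c)%R phi V N theta <=
   pressure_sum f Z a (phi \o pi) U N theta)%E.
Proof.
apply: le_ereal_inf_tmp => _ [G [cG GU ZG] <-].
(* Strings with empty string set may have no lift; they cover no point, and dropping them does not
   increase the sum. *)
pose G0 := [set s | G s /\ string_set f s !=set0].
have /choice[t tP] : forall s, exists t, G0 s ->
    [/\ size t = size s, string_over V t &
      pi @` string_set f s `<=` string_set g t].
  move=> s; have [[Gs s0]|ns] := pselect (G0 s); last by exists [::] => /ns.
  by have [t ?] := string_lift s (GU s Gs).1 s0; exists t.
apply: ge_ereal_inf; exists (\esum_(s in t @` G0) string_weight g (a + c) phi s)%E.
  exists (t @` G0) => //; split.
  - apply: sub_countable (card_image_le _ _) _.
    by apply: sub_countable cG; apply: subset_card_le => s [].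
  - move=> _ [s G0s <-]; have [-> Vt _] := tP s G0s.
    by split=> //; have [] := GU s G0s.1.
  - move=> _ [z Zz <-]; have [s Gs sz] := ZG z Zz.
    have G0s : G0 s by split=> //; exists z.
    have [_ _ st] := tP s G0s; exists (t s); first by exists s.
    by apply: st; exists z.
apply: (@le_trans _ _ (\esum_(s in G0) string_weight f a (phi \o pi) s)%E).
  apply: esum_image_le => s G0s; have [? ? ?] := tP s G0s.
  by apply: string_weight_lift => //; exact: G0s.2.
apply: ereal_sup_le => _ [S [finS SG0] <-]; exists S => //; split=> // s.
by move=> /SG0[].
Qed.

End Semiconjugacy.

(** Taking [L] to be [limn_einf] or [limn_esup] gives the lower or upper cover pressure, so one
    argument treats both. *)
Definition cover_pressure {R : realType} {X : metricType R}
    (L : (nat -> \bar R) -> \bar R) (f : nat -> X -> X) (Z : set X)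
    (phi : X -> R) (theta : R) (U : set (set X)) : \bar R :=
  ereal_inf [set a%:E | a in
    [set a | L (fun N => pressure_sum f Z a phi U N theta) = 0%E]].

Lemma pressure_sum_ge0 (R : realType) (X : metricType R) (f : nat -> X -> X)
    Z a phi U N theta : (0 <= pressure_sum f Z a phi U N theta :> \bar R)%E.
Proof.
apply: le_ereal_inf_tmp => _ [G _ <-]; apply: esum_ge0 => s _.
exact: expeR_ge0.
Qed.

(** * Finite open covers of small mesh *)

Lemma mesh_lt_mdist (R : realType) (X : metricType R) (U : set (set X))
    (d : R) A x y :
  (mesh U < d%:E)%E -> U A -> A x -> A y -> mdist x y < d.
Proof.
move=> Ud UA Ax Ay; rewrite -lte_fin; apply: le_lt_trans Ud.
apply: (@le_trans _ _ (diam A)).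
  by apply: ereal_sup_ubound; exists (x, y).
by apply: ereal_sup_ubound; exists A.
Qed.

#[local] Instance mesh_to0_filter (R : realType) (X : metricType R) :
  Filter (@mesh_to0 R X).
Proof.
apply: filter_from_filter => [|d e /= d0 e0]; first by exists 1 => /=.
exists (Num.min d e) => /= [|U [Uc Ude]]; first by rewrite lt_min d0.
by split; split=> //; apply: lt_le_trans Ude _;
  rewrite lee_fin ge_min lexx ?orbT.
Qed.

Lemma near_finite_open_cover (R : realType) (X : metricType R) :
  \forall U \near @mesh_to0 R X, finite_open_cover U.
Proof. by exists 1 => [|U []] //=. Qed.

Lemma near_mesh_lt (R : realType) (X : metricType R) (d : R) : 0 < d ->
  \forall U \near @mesh_to0 R X, (mesh U < d%:E)%E.
Proof. by move=> d0; exists d => // U []. Qed.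

(** Near-covering compactness is applied along the filter of finite sets ordered by inclusion: any
    finite set containing [x] serves all points near [x]. *)
Lemma compact_finite_net (R : realType) (X : metricType R) (e : R) :
  compact [set: X] -> 0 < e ->
  exists2 S : set X, finite_set S & forall x, exists2 c, S c & ball c e x.
Proof.
move=> /compact_near_coveringP cX e0.
pose F : set_system (set X) :=
  filter_from (@finite_set X) (fun S => [set S' | finite_set S' /\ S `<=` S']).
have FF : Filter F.
  apply: filter_from_filter; first by exists set0; exact: finite_set0.
  move=> S S' finS finS'; exists (S `|` S'); first by rewrite finite_setU.
  by move=> T [finT]; rewrite subUset => -[ST S'T].
have [|S finS] := cX _ F (fun S x => exists2 c, S c & ball c e x) FF.
  move=> x _; exists (ball x e, [set S | finite_set S /\ [set x] `<=` S]).
    by split; [exact: nbhsx_ballx|exists [set x] => //; exact: finite_set1].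
  by move=> [y S] /= [xy [_ xS]]; exists x => //; exact: xS.
by move=> SP; exists S => // x; apply: (SP S) => //=; split.
Qed.

Lemma mesh_to0_proper (R : realType) (X : metricType R) :
  compact [set: X] -> ProperFilter (@mesh_to0 R X).
Proof.
move=> cX; apply: filter_from_proper => e /= e0.
have e40 : 0 < e / 4 by rewrite divr_gt0.
have [S finS SP] := @compact_finite_net R X (e / 4 / 2) cX ltac:(lra).
(* Doubling the net radius [e / 8] puts every point in the interior of some ball, while diameters
   stay at most [e / 2]. *)
exists [set (ball c (e / 4))° | c in S]; split.
  split; first exact: finite_image.
    by move=> _ [c _ <-]; exact: open_interior.
  rewrite -subTset => x _; have [c Sc cx] := SP x.
  exists (ball c (e / 4))°; first by exists c.
  apply: (@filterS _ _ _ (ball x (e / 4 / 2))); last first.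
    by apply: nbhsx_ballx; lra.
  by move=> y xy; rewrite [e / 4]splitr; exact: ball_triangle cx xy.
apply: (@le_lt_trans _ _ (e / 2)%:E); last by rewrite lte_fin; lra.
apply: ge_ereal_sup => _ [_ [c Sc <-] <-].
apply: ge_ereal_sup => _ [[x y] [/= /interior_subset cx /interior_subset cy] <-].
move: cx cy; rewrite lee_fin !ballEmdist /= => cx cy.
by have := metric_triangle x c y; rewrite (metric_sym x c); lra.
Qed.

Lemma near_oscillation_le (R : realType) (Y : metricType R) (phi : Y -> R)
    (e : R) : compact [set: Y] -> continuous phi -> 0 < e ->
  \forall V \near @mesh_to0 R Y, forall B, V B ->
    forall y y', B y -> B y' -> phi y <= phi y' + e.
Proof.
move=> /compact_near_coveringP cY cphi e0.
(* Compactness makes one modulus of continuity [d] valid at all points. *)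
have : \forall d \near 0^'+, [set: Y] `<=`
    [set y | forall y', mdist y y' < d -> phi y <= phi y' + e].
  apply: cY => y _.
  have /nbhs_ballP[r /= r0 yr] : \forall y' \near y, `|phi y - phi y'| < e / 2.
    by have /cvgrPdist_lt := cphi y; apply; rewrite divr_gt0.
  exists (ball y (r / 2), [set d | d < r / 2]).
    split; first by apply: nbhsx_ballx; rewrite divr_gt0.
    by apply: nbhs_right_lt; rewrite divr_gt0.
  move=> [z d] /= [yz dr] y' zy'.
  have /yr /= : ball y r z by apply: le_ball yz; lra.
  have /yr /= : ball y r y'.
    rewrite [r]splitr; apply: ball_triangle yz _.
    by rewrite ballEmdist /=; exact: lt_trans dr.
  by rewrite !ltr_distl => /andP[? ?] /andP[? ?]; lra.
move=> dP; near (0 : R)^'+ => d.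
apply: filterS (@near_mesh_lt R Y d _) => // V Vd B VB y y' By By'.
have := near dP d; apply => //.
exact: mesh_lt_mdist Vd VB By By'.
Unshelve. all: by end_near. Qed.

Lemma near_refine (R : realType) (X Y : metricType R) (pi : X -> Y)
    (V : set (set Y)) :
  compact [set: X] -> continuous pi -> finite_open_cover V ->
  \forall U \near @mesh_to0 R X, forall A, U A -> A !=set0 ->
    exists2 B, V B & pi @` A `<=` B.
Proof.
move=> /compact_near_coveringP cX cpi [_ Vo VT].
(* Such a [d] is a Lebesgue number of the cover of [X] by the preimages of members of [V]. *)
have : \forall d \near 0^'+, [set: X] `<=`
    [set x | exists2 B, V B & pi @` ball x d `<=` B].
  apply: cX => x _.
  have [B VB Bx] : (\bigcup_(B in V) B) (pi x) by rewrite VT.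
  have /nbhs_ballP[r /= r0 xr] : nbhs x (pi @^-1` B).
    by apply: cpi; apply: open_nbhs_nbhs; split=> //; exact: Vo.
  exists (ball x (r / 2), [set d | d < r / 2]).
    split; first by apply: nbhsx_ballx; rewrite divr_gt0.
    by apply: nbhs_right_lt; rewrite divr_gt0.
  move=> [z d] /= [xz dr]; exists B => // _ [w zw <-]; apply: xr.
  rewrite [r]splitr; apply: ball_triangle xz _.
  by apply: le_ball zw; exact: ltW.
move=> dP; near (0 : R)^'+ => d.
apply: filterS (@near_mesh_lt R X d _) => // U Ud A UA [x Ax].
have [//|B VB xB] := near dP d _ x I; exists B => // _ [z Az <-]; apply: xB.
by exists z => //; rewrite ballEmdist; exact: mesh_lt_mdist Ud UA Ax Az.
Unshelve. all: by end_near. Qed.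

(** * Comparison of cover pressures and of their limits *)

Section PressureComparison.
Context {R : realType} (L : (nat -> \bar R) -> \bar R).
Hypothesis L_le : forall u v, (forall n, (u n <= v n)%E) -> (L u <= L v)%E.
Hypothesis L0 : L (fun=> 0%E) = 0%E.

(** If [L] vanishes on the sums for [f] at [a], then on those for [g] at [a + c] it is squeezed
    between [L 0 = 0] and that zero value. *)
Lemma cover_pressure_lift (X Y : metricType R)
    (f : nat -> X -> X) (g : nat -> Y -> Y) (pi : X -> Y)
    (phi : Y -> R) (U : set (set X)) (V : set (set Y)) (c : R) Z theta :
  (forall i, (1 <= i)%N -> pi \o f i = g i \o pi) ->
  (forall A, U A -> A !=set0 -> exists2 B, V B & pi @` A `<=` B) ->
  (forall B, V B -> forall y y', B y -> B y' -> phi y <= phi y' + c) ->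
  (cover_pressure L g (pi @` Z) phi theta V <=
   cover_pressure L f Z (phi \o pi) theta U + c%:E)%E.
Proof.
move=> semiconj refUV oscV; rewrite -leeBlDr//.
apply: le_ereal_inf_tmp => _ [a La <-]; rewrite leeBlDr// -EFinD.
apply: ereal_inf_lbound; exists (a + c) => //=; apply/le_anti/andP; split.
  rewrite -[leRHS]La; apply: L_le => N; exact: pressure_sum_lift.
by rewrite -[leLHS]L0; apply: L_le => N; exact: pressure_sum_ge0.
Qed.

Lemma near_cover_pressure_lift (X Y : metricType R)
    (f : nat -> X -> X) (g : nat -> Y -> Y) (pi : X -> Y) (phi : Y -> R)
    Z theta (e : R) :
  compact [set: X] -> compact [set: Y] -> continuous pi -> continuous phi ->
  (forall i, (1 <= i)%N -> pi \o f i = g i \o pi) -> 0 < e ->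
  \forall V \near @mesh_to0 R Y, \forall U \near @mesh_to0 R X,
    (cover_pressure L g (pi @` Z) phi theta V <=
     cover_pressure L f Z (phi \o pi) theta U + e%:E)%E.
Proof.
move=> cX cY cpi cphi semiconj e0.
have FX := @mesh_to0_proper R X cX; have FY := @mesh_to0_proper R Y cY.
apply: filterS2 (near_finite_open_cover R Y)
  (@near_oscillation_le R Y phi e cY cphi e0) => V Vc oscV.
apply: filterS (@near_refine R X Y pi V cX cpi Vc) => U refUV.
exact: cover_pressure_lift.
Qed.

Lemma cover_pressure_cvg (X : metricType R) (f : nat -> X -> X)
    (phi : X -> R) Z theta : compact [set: X] -> continuous phi ->
  exists l : \bar R,
    cover_pressure L f Z phi theta U @[U --> @mesh_to0 R X] --> l.
Proof.
move=> cX cphi; have FX := @mesh_to0_proper R X cX.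
apply: cvg_ereal_almost_le => e e0.
have := @near_cover_pressure_lift X X f f id phi Z theta e cX cX
  (fun=> cvg_id) cphi (fun _ _ => erefl) e0.
by rewrite image_id.
Qed.

Lemma pressure_factor_le (X Y : metricType R)
    (f : nat -> X -> X) (g : nat -> Y -> Y) (pi : X -> Y) (phi : Y -> R)
    Z theta :
  compact [set: X] -> compact [set: Y] -> continuous pi -> continuous phi ->
  (forall i, (1 <= i)%N -> pi \o f i = g i \o pi) ->
  (lim (cover_pressure L g (pi @` Z) phi theta V @[V --> @mesh_to0 R Y]) <=
   lim (cover_pressure L f Z (phi \o pi) theta U @[U --> @mesh_to0 R X]))%E.
Proof.
move=> cX cY cpi cphi semiconj.
have FX := @mesh_to0_proper R X cX; have FY := @mesh_to0_proper R Y cY.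
have [l gl] := @cover_pressure_cvg Y g phi (pi @` Z) theta cY cphi.
have cphipi : continuous (phi \o pi).
  by move=> x; apply: continuous_comp; [exact: cpi|exact: cphi].
have [m fm] := @cover_pressure_cvg X f (phi \o pi) Z theta cX cphipi.
(* Both limits exist, so neither [lim] is a default value. *)
rewrite (cvg_lim (@ereal_hausdorff R) gl) (cvg_lim (@ereal_hausdorff R) fm).
apply: lim_ereal_almost_le gl fm _ => e e0.
exact: near_cover_pressure_lift.
Qed.

End PressureComparison.

Lemma limn_esup_cst0 (R : realType) : limn_esup (fun=> 0%E : \bar R) = 0%E.
Proof. by have [_ ->] := cvg_limn_einf_sup (@cvg_cst _ (0%E : \bar R) _ \oo _). Qed.

Lemma limn_einf_cst0 (R : realType) : limn_einf (fun=> 0%E : \bar R) = 0%E.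
Proof. by have [-> _] := cvg_limn_einf_sup (@cvg_cst _ (0%E : \bar R) _ \oo _). Qed.

Theorem theorem4p1 (R : realType) (X Y : metricType R)
    (compactX : compact [set: X]) (compactY : compact [set: Y])
    (f : nat -> X -> X) (g : nat -> Y -> Y)
    (cf : forall i, (1 <= i)%N -> continuous (f i))
    (cg : forall i, (1 <= i)%N -> continuous (g i))
    (pi : X -> Y) (hpi : factor_map f g pi) :
  (forall (Z : set X) (theta : R) (phi : Y -> R),
     0 <= theta <= 1 -> continuous phi ->
     (lower_pressure g (pi @` Z) phi theta <=
        lower_pressure f Z (phi \o pi) theta)%E /\
     (upper_pressure g (pi @` Z) phi theta <=
        upper_pressure f Z (phi \o pi) theta)%E) /\
  (conjugacy f g pi ->
   forall (Z : set X) (theta : R) (phi : Y -> R),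
     0 <= theta <= 1 -> continuous phi ->
     lower_pressure f Z (phi \o pi) theta =
       lower_pressure g (pi @` Z) phi theta /\
     upper_pressure f Z (phi \o pi) theta =
       upper_pressure g (pi @` Z) phi theta).
Proof.
have le_factor (S T : metricType R) (u : nat -> S -> S) (v : nat -> T -> T)
    (h : S -> T) (Z : set S) (theta : R) (phi : T -> R) :
    compact [set: S] -> compact [set: T] -> continuous h -> continuous phi ->
    (forall i, (1 <= i)%N -> h \o u i = v i \o h) ->
    (lower_pressure v (h @` Z) phi theta <=
       lower_pressure u Z (phi \o h) theta)%E /\
    (upper_pressure v (h @` Z) phi theta <=
       upper_pressure u Z (phi \o h) theta)%E.
  move=> cS cT ch cphi hv; split.
    exact: (pressure_factor_le (@limn_einf R) (@limn_einf_le R)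
              (limn_einf_cst0 R)).
  exact: (pressure_factor_le (@limn_esup R) (@limn_esup_le R)
            (limn_esup_cst0 R)).
have [cpi _ pifg] := hpi; split=> [Z theta phi _ cphi|]; first exact: le_factor.
move=> [_ [_ [h [ch pih hpiK]]]] Z theta phi _ cphi.
(* The inverse is a semiconjugacy back: [h (g i y) = h (g i (pi (h y))) = h (pi (f i (h y))) = f i
   (h y)]. *)
have hgf i : (1 <= i)%N -> h \o g i = f i \o h.
  move=> i1; apply/funext => y /=; rewrite -[in LHS](hpiK y).
  by rewrite -[g i (pi _)](congr1 (fun k => k (h y)) (pifg i i1)) /= pih.
have [lo up] := le_factor X Y f g pi Z theta phi compactX compactY cpi cphi pifg.
have cphipi : continuous (phi \o pi).
  by move=> x; apply: continuous_comp; [exact: cpi|exact: cphi].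
have [] := le_factor Y X g f h (pi @` Z) theta (phi \o pi)
  compactY compactX ch cphipi hgf.
have -> : h @` (pi @` Z) = Z.
  by rewrite image_comp (_ : h \o pi = id) ?image_id//; apply/funext.
have -> : (phi \o pi) \o h = phi by apply/funext => y /=; rewrite hpiK.
by move=> lo' up'; split; apply/le_anti; rewrite ?lo ?up ?lo' ?up'.
Qed.
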